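(* Let $c$ be the Conway map from Conway forms to classical short normal-play games and let $c^{-1}$ be the map from classical short normal-play games to Conway forms, both defined in the context. (1) For any Conway forms $G,H$, if $G\geqslant H$ in the order of affine games, then $c(G)\geqslant c(H)$ in the order of classical normal play. (2) For any classical short normal-play games $G,H$, if $G\geqslant H$ in the order of classical normal play, then $c^{-1}(G)\geqslant c^{-1}(H)$ in the order of affine games.
   Context: Affine games are defined recursively. There are two games without options, denoted $\infty$ and $\overline{\infty}$ (terminating games). Every other affine game is a form $G=\{G^{\mathcal L}\mid G^{\mathcal R}\}$, where $G^{\mathcal L}$ (Left options) and $G^{\mathcal R}$ (Right options) are non-empty finite sets of previously constructed affine games. Let $\mathbb A$ be the set of all affine games. The followers of $G$ are $G$ itself and all games reachable from $G$ by a finite sequence of (not necessarily alternating) moves to options. Disjunctive sum: $G+H$ is undefined if one of $G,H$ is $\infty$ and the other is $\overline\infty$; it is $\infty$ if one is $\infty$ and the other is not $\overline\infty$; it is $\overline\infty$ if one is $\overline\infty$ and the other is not $\infty$; otherwise $G+H=\{G^{\mathcal L}+H,\,G+H^{\mathcal L}\mid G^{\mathcal R}+H,\,G+H^{\mathcal R}\}$. Outcomes: $o^L(G)=\mathbf L$ if $G=\infty$ or some $G^L\in G^{\mathcal L}$ has $o^R(G^L)=\mathbf L$, and $o^L(G)=\mathbf R$ otherwise; $o^R(G)=\mathbf R$ if $G=\overline\infty$ or some $G^R\in G^{\mathcal R}$ has $o^L(G^R)=\mathbf R$, and $o^R(G)=\mathbf L$ otherwise. With $\mathbf L>\mathbf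 R$, the outcome $o(G)=(o^L(G),o^R(G))$ is ordered componentwise. Order of affine games: $G\geqslant H$ iff $o(G+X)\geqslant o(H+X)$ for all $X\in\mathbb A\setminus\{\infty,\overline\infty\}$. A game is a check if $\infty$ is one of its Left options or $\overline\infty$ is one of its Right options. A Conway form is an affine game form that is distinct from $\infty$ and $\overline\infty$ and has no checks as followers. Classical normal play: short (finite, loop-free) partizan games $\{G^{\mathcal L}\mid G^{\mathcal R}\}$ with finite, possibly empty, option sets, where the player unable to move loses, with the usual partial order ($G\geqslant H$ iff Left wins $G-H$ playing second). Conway map $c$ (recursive, from Conway forms to classical normal-play games): $c(G)=\{\emptyset\mid\emptyset\}$ if $G=\{\overline\infty\mid\infty\}$; $c(G)=\{\emptyset\mid c(G^{\mathcal R})\}$ if $G=\{\overline\infty\mid G^{\mathcal R}\}$ and $G^{\mathcal R}\neq\{\infty\}$; $c(G)=\{c(G^{\mathcal L})\mid\emptyset\}$ if $G=\{G^{\mathcal L}\mid\infty\}$ and $G^{\mathcal L}\neq\{\overline\infty\}$; and $c(G)=\{c(G^{\mathcal L})\mid c(G^{\mathcal R})\}$ otherwise. Here $c(G^{\mathcal L})$ means $\{c(G^L):G^L\in G^{\mathcal L}\}$, and likewise $c(G^{\mathcal R})$ means $\{c(G^R):G^R\in G^{\mathcal R}\}$. The map $c^{-1}$ (recursive, from classical normal-play games to Conway forms): $c^{-1}(G)=\{\overline\infty\mid\infty\}$ if $G=\{\emptyset\mid\emptyset\}$; $c^{-1}(G)=\{\overline\infty\mid c^{-1}(G^{\mathcal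 R})\}$ if $G=\{\emptyset\mid G^{\mathcal R}\}$ and $G^{\mathcal R}\ne\emptyset$; $c^{-1}(G)=\{c^{-1}(G^{\mathcal L})\mid\infty\}$ if $G=\{G^{\mathcal L}\mid\emptyset\}$ and $G^{\mathcal L}\neq\emptyset$; and $c^{-1}(G)=\{c^{-1}(G^{\mathcal L})\mid c^{-1}(G^{\mathcal R})\}$ otherwise, with $c^{-1}$ applied to each option of the set.
   Formalization: The Conway map as written is undefined on Conway forms such as {∞̄, 0 | 0}, since it would need c(∞̄); here terminating options are dropped when forming c(G^L) and c(G^R), which changes nothing where the original recursion is defined. *)

(* Defs.v *)
From Stdlib Require Import List Bool.
Import ListNotations.

(* Sets of options are represented by lists: order and multiplicity carry no
   meaning, and every notion below depends only on the underlying sets (an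
   equality such as "G^L = {oo}" becomes "every listed Left option is oo"). *)

(* [Infty] and [Inftybar] are the two terminating games.  [Form l ls r rs] is
   { l :: ls | r :: rs }, so non-emptiness of both option sets is built in. *)
Inductive affine : Type :=
| Infty
| Inftybar
| Form (l : affine) (ls : list affine) (r : affine) (rs : list affine).

Definition left_options (G : affine) : list affine :=
  match G with Form l ls _ _ => l :: ls | _ => [] end.

Definition right_options (G : affine) : list affine :=
  match G with Form _ _ r rs => r :: rs | _ => [] end.

Definition is_infty (G : affine) : bool :=
  match G with Infty => true | _ => false end.

Definition is_inftybar (G : affine) : bool :=
  match G with Inftybar => true | _ => false end.

Definition terminating (G : affine) : bool := is_infty G || is_inftybar G.

Inductive follower (G : affine) : affine -> Prop :=
| follower_refl : follower G G
| follower_left K K' :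
    follower G K -> In K' (left_options K) -> follower G K'
| follower_right K K' :
    follower G K -> In K' (right_options K) -> follower G K'.

(* The sums [Infty] + [Inftybar] and [Inftybar] + [Infty] are undefined; the
   value [Infty] given to them is arbitrary.  It is never used when at least
   one summand is non-terminating: the recursive calls are made only when both
   summands are forms, and keep one of these two forms as a summand. *)
Fixpoint affine_add (G : affine) : affine -> affine :=
  fix add_G (H : affine) : affine :=
    match G, H with
    | Infty, Inftybar | Inftybar, Infty => Infty
    | Infty, _ | _, Infty => Infty
    | Inftybar, _ | _, Inftybar => Inftybar
    | Form gl gls gr grs, Form hl hls hr hrs =>
        Form (affine_add gl H)
             (map (fun g => affine_add g H) gls ++ add_G hl :: map add_G hls)
             (affine_add gr H)
             (map (fun g => affine_add g H) grs ++ add_G hr :: map add_G hrs)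
    end.

Inductive player : Type := L | R.

Definition is_L (p : player) : bool := match p with L => true | R => false end.
Definition is_R (p : player) : bool := match p with L => false | R => true end.

Fixpoint outcome_L (G : affine) : player :=
  match G with
  | Infty => L
  | Inftybar => R
  | Form l ls _ _ =>
      if is_L (outcome_R l) || existsb (fun g => is_L (outcome_R g)) ls
      then L else R
  end
with outcome_R (G : affine) : player :=
  match G with
  | Inftybar => R
  | Infty => L
  | Form _ _ r rs =>
      if is_R (outcome_L r) || existsb (fun g => is_R (outcome_L g)) rs
      then R else L
  end.

Definition outcome (G : affine) : player * player := (outcome_L G, outcome_R G).

(* The order with L > R. *)
Definition player_ge (p q : player) : Prop := p = L \/ q = R.

Definition outcome_ge (a b : player * player) : Prop :=
  player_ge (fst a) (fst b) /\ player_ge (snd a) (snd b).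

Definition affine_ge (G H : affine) : Prop :=
  forall X : affine, X <> Infty -> X <> Inftybar ->
    outcome_ge (outcome (affine_add G X)) (outcome (affine_add H X)).

Definition is_check (G : affine) : Prop :=
  In Infty (left_options G) \/ In Inftybar (right_options G).

Definition conway_form (G : affine) : Prop :=
  G <> Infty /\ G <> Inftybar /\ forall K, follower G K -> ~ is_check K.

(* Classical short normal-play games. *)
Inductive game : Type := Game (l r : list game).

Fixpoint game_opp (G : game) : game :=
  match G with Game l r => Game (map game_opp r) (map game_opp l) end.

Fixpoint game_add (G : game) : game -> game :=
  fix add_G (H : game) : game :=
    match G, H with
    | Game gl gr, Game hl hr =>
        Game (map (fun g => game_add g H) gl ++ map add_G hl)
             (map (fun g => game_add g H) gr ++ map add_G hr)
    end.

(* Under normal play a player unable to move loses: Left playing first needs a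
   winning move, and Left playing second needs an answer to every Right move,
   vacuously so when Right has none. *)
Fixpoint left_wins_first (G : game) : bool :=
  match G with Game l _ => existsb left_wins_second l end
with left_wins_second (G : game) : bool :=
  match G with Game _ r => forallb left_wins_first r end.

Definition game_ge (G H : game) : Prop :=
  left_wins_second (game_add G (game_opp H)) = true.

(* The map c.  Its value at the terminating games, which are not Conway forms,
   is irrelevant.  A Conway form may have [Inftybar] among its Left options (or
   [Infty] among its Right options) next to other options; as c has no value
   there, [image] keeps the values of c at the non-terminating options only. *)
Fixpoint conway_map (G : affine) : game :=
  match G with
  | Infty | Inftybar => Game [] []
  | Form l ls r rs =>
      let image1 g := if terminating g then [] else [conway_map g] in
      let image g gs := image1 g ++ flat_map image1 gs in
      match forallb is_inftybar (l :: ls), forallb is_infty (r :: rs) with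
      | true, true => Game [] []
      | true, false => Game [] (image r rs)
      | false, true => Game (image l ls) []
      | false, false => Game (image l ls) (image r rs)
      end
  end.

Fixpoint conway_inv (G : game) : affine :=
  match G with
  | Game l r =>
      match map conway_inv l, map conway_inv r with
      | [], [] => Form Inftybar [] Infty []
      | [], r0 :: rs => Form Inftybar [] r0 rs
      | l0 :: ls, [] => Form l0 ls Infty []
      | l0 :: ls, r0 :: rs => Form l0 ls r0 rs
      end
  end.

Lemma conway_inv_nonterminating (G : game) :
  conway_inv G <> Infty /\ conway_inv G <> Inftybar.
Proof.
destruct G as [l r]; cbn.
destruct (map conway_inv l), (map conway_inv r); split; discriminate.
Qed.

Lemma conway_inv_options (G : game) :
  (forall K, In K (left_options (conway_inv G)) ->
     K = Inftybar \/ exists G', K = conway_inv G') /\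
  (forall K, In K (right_options (conway_inv G)) ->
     K = Infty \/ exists G', K = conway_inv G').
Proof.
assert (aux : forall s K, In K (map conway_inv s) ->
              exists G', K = conway_inv G').
{ intros s K HK; apply in_map_iff in HK.
  destruct HK as [G' [E _]]; exists G'; symmetry; exact E. }
destruct G as [l r]; cbn.
pose proof (aux l) as Hl; pose proof (aux r) as Hr.
destruct (map conway_inv l), (map conway_inv r); cbn in *;
  split; intros K HK; intuition.
Qed.

(* The values of [conway_inv] are indeed Conway forms. *)
Lemma conway_inv_form (G : game) : conway_form (conway_inv G).
Proof.
destruct (conway_inv_nonterminating G) as [n1 n2].
split; [exact n1 | split; [exact n2 |]].
assert (key : forall K, follower (conway_inv G) K ->
   K = Infty \/ K = Inftybar \/ exists G', K = conway_inv G').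
{ intros K HK; induction HK as [|K K' _ IH HK'|K K' _ IH HK'].
  - right; right; exists G; reflexivity.
  - destruct IH as [->|[->|[G' ->]]]; [destruct HK' | destruct HK' |].
    apply conway_inv_options in HK'; tauto.
  - destruct IH as [->|[->|[G' ->]]]; [destruct HK' | destruct HK' |].
    apply conway_inv_options in HK'; tauto. }
intros K HK; destruct (key K HK) as [->|[->|[G' ->]]]; intros [H|H];
  try exact H.
- destruct (proj1 (conway_inv_options G') _ H) as [E|[G'' E]];
    [discriminate | exact (proj1 (conway_inv_nonterminating G'') (eq_sym E))].
- destruct (proj2 (conway_inv_options G') _ H) as [E|[G'' E]];
    [discriminate | exact (proj2 (conway_inv_nonterminating G'') (eq_sym E))].
Qed.

(* Main.v *)
(* Two facts about play carry the proof.  First, in a sum of Conway forms a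
   move to a terminating game loses at once for the player who makes it, so a
   sum of Conway forms has the same winner as the classical sum of its images
   under c.  Testing [G >= H] against [X = c^-1(- c(H))] then gives (1), since
   [c(H) - c(H) >= 0] and [c (c^-1 K) = K].  Second, for (2), Left combines a
   winning strategy in [c^-1(H) + X] with one, playing second, in [G - H] to
   win [c^-1(G) + X]; this works for every non-terminating [X], with or without
   checks, because Conway forms themselves never threaten to end the game. *)

From Stdlib Require Import List Arith Lia.
Require Import Defs.
Import ListNotations.

(** * Options and sizes of games *)

Definition left_moves (G : game) : list game := let (l, _) := G in l.
Definition right_moves (G : game) : list game := let (_, r) := G in r.

(** The main inductions below follow play in several games at once, so they run on sums of such
    sizes; only the strict decrease from a game to its options matters. *)
Fixpoint game_size (G : game) : nat :=
  match G with
  | Game l r => S (list_sum (map game_size l) + list_sum (map game_size r))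
  end.

Fixpoint affine_size (G : affine) : nat :=
  match G with
  | Infty | Inftybar => 0
  | Form l ls r rs =>
      S (affine_size l + list_sum (map affine_size ls) +
         (affine_size r + list_sum (map affine_size rs)))
  end.

Lemma in_list_sum_map {A : Type} (f : A -> nat) (s : list A) (x : A) :
  In x s -> f x <= list_sum (map f s).
Proof.
unfold list_sum; induction s as [|y s IH]; cbn; [easy|].
intros [->|Hx]; [lia | specialize (IH Hx); lia].
Qed.

Lemma left_moves_size (G K : game) :
  In K (left_moves G) -> game_size K < game_size G.
Proof.
destruct G as [l r]; cbn; intros HK.
apply (in_list_sum_map game_size) in HK; lia.
Qed.

Lemma right_moves_size (G K : game) :
  In K (right_moves G) -> game_size K < game_size G.
Proof.
destruct G as [l r]; cbn; intros HK.
apply (in_list_sum_map game_size) in HK; lia.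
Qed.

Lemma left_options_size (G K : affine) :
  In K (left_options G) -> affine_size K < affine_size G.
Proof.
destruct G as [| |l ls r rs]; cbn [left_options]; try easy.
intros HK.
apply (in_list_sum_map affine_size) in HK.
change (affine_size K <= affine_size l + list_sum (map affine_size ls)) in HK.
cbn; lia.
Qed.

Lemma right_options_size (G K : affine) :
  In K (right_options G) -> affine_size K < affine_size G.
Proof.
destruct G as [| |l ls r rs]; cbn [right_options]; try easy.
intros HK.
apply (in_list_sum_map affine_size) in HK.
change (affine_size K <= affine_size r + list_sum (map affine_size rs)) in HK.
cbn; lia.
Qed.

(** * Classical play *)

Lemma left_wins_firstP (G : game) :
  left_wins_first G = true <->
  exists K, In K (left_moves G) /\ left_wins_second K = true.
Proof. destruct G; apply existsb_exists. Qed.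

Lemma left_wins_secondP (G : game) :
  left_wins_second G = true <->
  forall K, In K (right_moves G) -> left_wins_first K = true.
Proof. destruct G; apply forallb_forall. Qed.

Lemma left_moves_add (G H K : game) :
  In K (left_moves (game_add G H)) <->
  (exists G', In G' (left_moves G) /\ K = game_add G' H) \/
  (exists H', In H' (left_moves H) /\ K = game_add G H').
Proof.
destruct G as [gl gr], H as [hl hr]; cbn.
rewrite in_app_iff, !in_map_iff.
split; (intros [[x [? ?]]|[x [? ?]]]; [left|right]; exists x; auto).
Qed.

Lemma right_moves_add (G H K : game) :
  In K (right_moves (game_add G H)) <->
  (exists G', In G' (right_moves G) /\ K = game_add G' H) \/
  (exists H', In H' (right_moves H) /\ K = game_add G H').
Proof.
destruct G as [gl gr], H as [hl hr]; cbn.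
rewrite in_app_iff, !in_map_iff.
split; (intros [[x [? ?]]|[x [? ?]]]; [left|right]; exists x; auto).
Qed.

Lemma left_moves_opp (G : game) :
  left_moves (game_opp G) = map game_opp (right_moves G).
Proof. destruct G; reflexivity. Qed.

Lemma right_moves_opp (G : game) :
  right_moves (game_opp G) = map game_opp (left_moves G).
Proof. destruct G; reflexivity. Qed.

(** A Left move in [game_opp H] is the negative of a Right move in [H]. Together with [game_geP],
    this lets later proofs compare options directly, with no appeal to transitivity or to the group
    laws of classical games. *)
Lemma left_wins_first_sub (G H : game) :
  left_wins_first (game_add G (game_opp H)) = true <->
  (exists K, In K (left_moves G) /\ game_ge K H) \/
  (exists K, In K (right_moves H) /\ game_ge G K).
Proof.
rewrite left_wins_firstP; split.
- intros [K [HK W]]; apply left_moves_add in HK.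
  rewrite left_moves_opp in HK.
  destruct HK as [[G' [HG ->]]|[H' [HH ->]]].
  + left; exists G'; auto.
  + apply in_map_iff in HH; destruct HH as [K [<- HK]].
    right; exists K; auto.
- intros [[K [HK W]]|[K [HK W]]].
  + exists (game_add K (game_opp H)); split; [|exact W].
    apply left_moves_add; left; exists K; auto.
  + exists (game_add G (game_opp K)); split; [|exact W].
    apply left_moves_add; right; exists (game_opp K); split; [|reflexivity].
    rewrite left_moves_opp; apply in_map; exact HK.
Qed.

Lemma game_geP (G H : game) :
  game_ge G H <->
  (forall K, In K (right_moves G) ->
     left_wins_first (game_add K (game_opp H)) = true) /\
  (forall K, In K (left_moves H) ->
     left_wins_first (game_add G (game_opp K)) = true).
Proof.
unfold game_ge; rewrite left_wins_secondP; split.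
- intros W; split; intros K HK; apply W, right_moves_add.
  + left; exists K; auto.
  + right; exists (game_opp K); split; [|reflexivity].
    rewrite right_moves_opp; apply in_map; exact HK.
- intros [W1 W2] K HK; apply right_moves_add in HK.
  rewrite right_moves_opp in HK.
  destruct HK as [[G' [HG ->]]|[H' [HH ->]]]; [auto|].
  apply in_map_iff in HH; destruct HH as [K [<- HK]]; auto.
Qed.

(** The mirror strategy: Left answers a move in one component of [G - G] with the corresponding move
    in the other, reaching a difference [K - K] with [K] an option of [G]. *)
Lemma game_ge_refl (G : game) : game_ge G G.
Proof.
induction G as [G IH] using (well_founded_induction
  (Wf_nat.well_founded_ltof game game_size)).
apply game_geP; split; intros K HK; apply left_wins_first_sub.
- right; exists K; split; [exact HK | apply IH, right_moves_size, HK].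
- left; exists K; split; [exact HK | apply IH, left_moves_size, HK].
Qed.

(** * Affine play *)

(** Terminating games have to be excluded: [Infty] is won by Left although it offers no option to
    move to. *)
Lemma outcome_LP (G : affine) : terminating G = false ->
  outcome_L G = L <-> exists K, In K (left_options G) /\ outcome_R K = L.
Proof.
destruct G as [| |l ls r rs]; try discriminate; intros _.
(* The separate test of the head option and the [existsb] over the others are by conversion one
   [existsb] over all Left options. *)
change (outcome_L (Form l ls r rs)) with
  (if existsb (fun g => is_L (outcome_R g)) (l :: ls) then L else R).
change (left_options (Form l ls r rs)) with (l :: ls).
assert (E : forall K, is_L (outcome_R K) = true <-> outcome_R K = L)
  by (intros K; destruct (outcome_R K); cbn; intuition discriminate).
destruct (existsb _ _) eqn:B.
- apply existsb_exists in B; destruct B as [K [HK W]].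
  split; [intros _; exists K; split; [exact HK | apply E, W] | reflexivity].
- split; [discriminate|]; intros [K [HK W]].
  apply E in W.
  rewrite (proj2 (existsb_exists _ _) (ex_intro _ K (conj HK W))) in B.
  discriminate.
Qed.

Lemma outcome_RP (G : affine) : terminating G = false ->
  outcome_R G = L <-> forall K, In K (right_options G) -> outcome_L K = L.
Proof.
destruct G as [| |l ls r rs]; try discriminate; intros _.
change (outcome_R (Form l ls r rs)) with
  (if existsb (fun g => is_R (outcome_L g)) (r :: rs) then R else L).
change (right_options (Form l ls r rs)) with (r :: rs).
assert (E : forall K, is_R (outcome_L K) = true <-> outcome_L K <> L)
  by (intros K; destruct (outcome_L K); cbn; intuition congruence).
destruct (existsb _ _) eqn:B.
- apply existsb_exists in B; destruct B as [K [HK W]].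
  split; [discriminate | intros F; apply E in W; elim W; auto].
- split; [|reflexivity]; intros _ K HK.
  destruct (outcome_L K) eqn:W; [reflexivity|].
  assert (W' : is_R (outcome_L K) = true) by (rewrite W; reflexivity).
  rewrite (proj2 (existsb_exists _ _) (ex_intro _ K (conj HK W'))) in B.
  discriminate.
Qed.

Lemma terminating_add (G H : affine) :
  terminating G = false -> terminating H = false ->
  terminating (affine_add G H) = false.
Proof. destruct G, H; easy. Qed.

Lemma add_Infty_l (G : affine) :
  terminating G = false -> affine_add Infty G = Infty.
Proof. destruct G; easy. Qed.

Lemma add_Inftybar_l (G : affine) :
  terminating G = false -> affine_add Inftybar G = Inftybar.
Proof. destruct G; easy. Qed.

Lemma add_Infty_r (G : affine) :
  terminating G = false -> affine_add G Infty = Infty.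
Proof. destruct G; easy. Qed.

Lemma add_Inftybar_r (G : affine) :
  terminating G = false -> affine_add G Inftybar = Inftybar.
Proof. destruct G; easy. Qed.

Lemma left_options_add (G H K : affine) :
  terminating G = false -> terminating H = false ->
  In K (left_options (affine_add G H)) <->
  (exists G', In G' (left_options G) /\ K = affine_add G' H) \/
  (exists H', In H' (left_options H) /\ K = affine_add G H').
Proof.
destruct G as [| |gl gls gr grs], H as [| |hl hls hr hrs]; try discriminate.
intros _ _.
set (G := Form gl gls gr grs); set (H := Form hl hls hr hrs).
(* The head and tail that [affine_add] builds separately are by conversion the concatenation of two
   maps over the full option lists. *)
change (left_options (affine_add G H)) with
  (map (fun g => affine_add g H) (left_options G) ++
   map (affine_add G) (left_options H)).
rewrite in_app_iff, !in_map_iff.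
split; (intros [[x [? ?]]|[x [? ?]]]; [left|right]; exists x; auto).
Qed.

Lemma right_options_add (G H K : affine) :
  terminating G = false -> terminating H = false ->
  In K (right_options (affine_add G H)) <->
  (exists G', In G' (right_options G) /\ K = affine_add G' H) \/
  (exists H', In H' (right_options H) /\ K = affine_add G H').
Proof.
destruct G as [| |gl gls gr grs], H as [| |hl hls hr hrs]; try discriminate.
intros _ _.
set (G := Form gl gls gr grs); set (H := Form hl hls hr hrs).
change (right_options (affine_add G H)) with
  (map (fun g => affine_add g H) (right_options G) ++
   map (affine_add G) (right_options H)).
rewrite in_app_iff, !in_map_iff.
split; (intros [[x [? ?]]|[x [? ?]]]; [left|right]; exists x; auto).
Qed.

Lemma outcome_L_add (G H : affine) :
  terminating G = false -> terminating H = false ->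
  outcome_L (affine_add G H) = L <->
  (exists G', In G' (left_options G) /\ outcome_R (affine_add G' H) = L) \/
  (exists H', In H' (left_options H) /\ outcome_R (affine_add G H') = L).
Proof.
intros tG tH; rewrite outcome_LP by (apply terminating_add; assumption).
split.
- intros [K [HK W]]; apply left_options_add in HK; [|assumption..].
  destruct HK as [[G' [HG ->]]|[H' [HH ->]]]; eauto.
- intros [[K [HK W]]|[K [HK W]]]; eexists;
    (split; [apply left_options_add; eauto | exact W]).
Qed.

Lemma outcome_R_add (G H : affine) :
  terminating G = false -> terminating H = false ->
  outcome_R (affine_add G H) = L <->
  (forall G', In G' (right_options G) -> outcome_L (affine_add G' H) = L) /\
  (forall H', In H' (right_options H) -> outcome_L (affine_add G H') = L).
Proof.
intros tG tH; rewrite outcome_RP by (apply terminating_add; assumption).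
split.
- intros W; split; intros K HK; apply W, right_options_add; eauto.
- intros [W1 W2] K HK; apply right_options_add in HK; [|assumption..].
  destruct HK as [[G' [HG ->]]|[H' [HH ->]]]; auto.
Qed.

(** * Conway forms and the maps c and c^-1 *)

Lemma conway_form_terminating (G : affine) :
  conway_form G -> terminating G = false.
Proof. intros [n1 [n2 _]]; destruct G; easy. Qed.

Lemma follower_trans (G H K : affine) :
  follower G H -> follower H K -> follower G K.
Proof.
intros GH HK; induction HK; eauto using follower_left, follower_right.
Qed.

(** [Infty] as a Left option would make [G] itself a check, and the followers of an option are
    followers of [G]. So the only terminating Left option possible is [Inftybar], a move that hands
    Right the win. *)
Lemma conway_form_left (G K : affine) :
  conway_form G -> In K (left_options G) -> K = Inftybar \/ conway_form K.
Proof.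
intros [_ [_ F]] HK.
destruct K eqn:E; [|left; reflexivity|right].
- elim (F G (follower_refl G)); left; exact HK.
- rewrite <- E in *; repeat split; try (rewrite E; discriminate).
  intros K' HK'; apply F.
  exact (follower_trans _ _ _ (follower_left _ _ _ (follower_refl G) HK) HK').
Qed.

Lemma conway_form_right (G K : affine) :
  conway_form G -> In K (right_options G) -> K = Infty \/ conway_form K.
Proof.
intros [_ [_ F]] HK.
destruct K eqn:E; [left; reflexivity| |right].
- elim (F G (follower_refl G)); right; exact HK.
- rewrite <- E in *; repeat split; try (rewrite E; discriminate).
  intros K' HK'; apply F.
  exact (follower_trans _ _ _ (follower_right _ _ _ (follower_refl G) HK) HK').
Qed.

(** A named copy of the local [image] in [conway_map], taken over the whole option list instead of
    head and tail. *)
Definition conway_image (s : list affine) : list game :=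
  flat_map (fun g => if terminating g then [] else [conway_map g]) s.

Lemma in_conway_image (s : list affine) (K : game) :
  In K (conway_image s) <->
  exists g, In g s /\ terminating g = false /\ K = conway_map g.
Proof.
unfold conway_image; rewrite in_flat_map.
split; intros [g [Hg HK]]; exists g; split; try exact Hg.
- destruct (terminating g); [destruct HK | destruct HK as [<-|[]]; auto].
- destruct HK as [-> ->]; left; reflexivity.
Qed.

Lemma conway_image_nil (s : list affine) :
  forallb terminating s = true -> conway_image s = [].
Proof.
induction s as [|g s IH]; cbn; [reflexivity|].
destruct (terminating g); cbn; [exact IH | discriminate].
Qed.

(* The case distinction in the definition of c is redundant. *)
Lemma conway_map_form (l : affine) (ls : list affine) (r : affine)
    (rs : list affine) :
  conway_map (Form l ls r rs) =
  Game (conway_image (l :: ls)) (conway_image (r :: rs)).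
Proof.
assert (E : forall (p : affine -> bool) s,
  (forall g, p g = true -> terminating g = true) ->
  forallb p s = true -> conway_image s = []).
{ intros p s Hp Hs; apply conway_image_nil, forallb_forall.
  intros g Hg; apply Hp; exact (proj1 (forallb_forall _ _) Hs g Hg). }
assert (El := E is_inftybar (l :: ls)); assert (Er := E is_infty (r :: rs)).
change (conway_map (Form l ls r rs)) with
  (match forallb is_inftybar (l :: ls), forallb is_infty (r :: rs) with
   | true, true => Game [] []
   | true, false => Game [] (conway_image (r :: rs))
   | false, true => Game (conway_image (l :: ls)) []
   | false, false => Game (conway_image (l :: ls)) (conway_image (r :: rs))
   end).
destruct (forallb is_inftybar _); [rewrite El|];
  try (destruct (forallb is_infty _); [rewrite Er|]); try reflexivity;
  intros []; easy.
Qed.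

Lemma left_moves_conway_map (G : affine) (K : game) :
  In K (left_moves (conway_map G)) <->
  exists g, In g (left_options G) /\ terminating g = false /\ K = conway_map g.
Proof.
destruct G; [firstorder..|].
rewrite conway_map_form; apply in_conway_image.
Qed.

Lemma right_moves_conway_map (G : affine) (K : game) :
  In K (right_moves (conway_map G)) <->
  exists g, In g (right_options G) /\ terminating g = false /\ K = conway_map g.
Proof.
destruct G; [firstorder..|].
rewrite conway_map_form; apply in_conway_image.
Qed.

Lemma conway_inv_terminating (G : game) : terminating (conway_inv G) = false.
Proof. apply conway_form_terminating, conway_inv_form. Qed.

Lemma left_options_conway_inv (G : game) :
  left_options (conway_inv G) =
  match left_moves G with [] => [Inftybar] | s => map conway_inv s end.
Proof. destruct G as [[|] [|]]; reflexivity. Qed.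

Lemma right_options_conway_inv (G : game) :
  right_options (conway_inv G) =
  match right_moves G with [] => [Infty] | s => map conway_inv s end.
Proof. destruct G as [[|] [|]]; reflexivity. Qed.

Lemma in_left_conway_inv (G K : game) :
  In K (left_moves G) -> In (conway_inv K) (left_options (conway_inv G)).
Proof.
rewrite left_options_conway_inv; intros HK.
destruct (left_moves G); [destruct HK | apply in_map, HK].
Qed.

Lemma in_right_conway_inv (G K : game) :
  In K (right_moves G) -> In (conway_inv K) (right_options (conway_inv G)).
Proof.
rewrite right_options_conway_inv; intros HK.
destruct (right_moves G); [destruct HK | apply in_map, HK].
Qed.

Lemma left_conway_inv_cases (G : game) (K : affine) :
  In K (left_options (conway_inv G)) ->
  K = Inftybar \/ exists G', In G' (left_moves G) /\ K = conway_inv G'.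
Proof.
rewrite left_options_conway_inv; destruct (left_moves G) as [|g s].
- intros [<-|[]]; auto.
- intros HK; apply in_map_iff in HK; destruct HK as [G' [<- HG]]; eauto.
Qed.

Lemma right_conway_inv_cases (G : game) (K : affine) :
  In K (right_options (conway_inv G)) ->
  K = Infty \/ exists G', In G' (right_moves G) /\ K = conway_inv G'.
Proof.
rewrite right_options_conway_inv; destruct (right_moves G) as [|g s].
- intros [<-|[]]; auto.
- intros HK; apply in_map_iff in HK; destruct HK as [G' [<- HG]]; eauto.
Qed.

(** The terminating option that [conway_inv] inserts for an empty option set is dropped again by
    [conway_image]; every other option is non-terminating and is restored by induction. The equality
    is literal, order of the lists included. *)
Lemma conway_invK (G : game) : conway_map (conway_inv G) = G.
Proof.
induction G as [G IH] using (well_founded_induction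
  (Wf_nat.well_founded_ltof game game_size)).
assert (E : forall s, (forall K, In K s -> game_size K < game_size G) ->
  conway_image (map conway_inv s) = s).
{ induction s as [|g s IHs]; intros Hs; [reflexivity|]; cbn.
  rewrite conway_inv_terminating, IH by (apply Hs; left; reflexivity).
  cbn; f_equal; apply IHs; intros K HK; apply Hs; right; exact HK. }
assert (El := E (left_moves G) (left_moves_size G)).
assert (Er := E (right_moves G) (right_moves_size G)).
assert (Fl := left_options_conway_inv G).
assert (Fr := right_options_conway_inv G).
assert (t := conway_inv_terminating G).
destruct (conway_inv G) as [| |l ls r rs]; [discriminate..|].
cbn [left_options right_options] in Fl, Fr.
rewrite conway_map_form, Fl, Fr.
destruct G as [[|gl gls] [|gr grs]]; cbn [left_moves right_moves] in *;
  rewrite ?El, ?Er; reflexivity.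
Qed.

(** * The two implications *)

(** Both equivalences are proved together because each move passes the turn. The options of a Conway
    form that [conway_map] forgets are losing moves: [Inftybar] for Left, [Infty] for Right, each
    absorbing the other summand. The remaining options are Conway forms and match the classical
    moves. *)
Lemma outcome_conway_add (G H : affine) : conway_form G -> conway_form H ->
  (outcome_L (affine_add G H) = L <->
   left_wins_first (game_add (conway_map G) (conway_map H)) = true) /\
  (outcome_R (affine_add G H) = L <->
   left_wins_second (game_add (conway_map G) (conway_map H)) = true).
Proof.
remember (affine_size G + affine_size H) as n eqn:En.
revert G H En; induction n as [n IH] using lt_wf_ind; intros G H -> cG cH.
assert (tG := conway_form_terminating G cG).
assert (tH := conway_form_terminating H cH).
assert (IHG : forall G', affine_size G' < affine_size G -> conway_form G' -> _)
  by (intros G' s c; refine (IH _ _ G' H eq_refl c cH); lia).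
assert (IHH : forall H', affine_size H' < affine_size H -> conway_form H' -> _)
  by (intros H' s c; refine (IH _ _ G H' eq_refl cG c); lia).
clear IH; split.
- rewrite outcome_L_add, left_wins_firstP by assumption; split.
  + intros [[K [HK W]]|[K [HK W]]].
    * destruct (conway_form_left G K cG HK) as [->|cK].
      { rewrite add_Inftybar_l in W by exact tH; discriminate. }
      exists (game_add (conway_map K) (conway_map H)); split.
      -- apply left_moves_add; left; exists (conway_map K); split; [|easy].
         apply left_moves_conway_map; exists K.
         auto using conway_form_terminating.
      -- apply (IHG K); auto using left_options_size.
    * destruct (conway_form_left H K cH HK) as [->|cK].
      { rewrite add_Inftybar_r in W by exact tG; discriminate. }
      exists (game_add (conway_map G) (conway_map K)); split.
      -- apply left_moves_add; right; exists (conway_map K); split; [|easy].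
         apply left_moves_conway_map; exists K.
         auto using conway_form_terminating.
      -- apply (IHH K); auto using left_options_size.
  + intros [K [HK W]]; apply left_moves_add in HK.
    destruct HK as [[K' [HK ->]]|[K' [HK ->]]];
      apply left_moves_conway_map in HK; destruct HK as [g [Hg [tg ->]]].
    * left; exists g; split; [exact Hg|].
      destruct (conway_form_left G g cG Hg) as [->|cg]; [discriminate|].
      apply (IHG g); auto using left_options_size.
    * right; exists g; split; [exact Hg|].
      destruct (conway_form_left H g cH Hg) as [->|cg]; [discriminate|].
      apply (IHH g); auto using left_options_size.
- rewrite outcome_R_add, left_wins_secondP by assumption; split.
  + intros [WG WH] K HK; apply right_moves_add in HK.
    destruct HK as [[K' [HK ->]]|[K' [HK ->]]];
      apply right_moves_conway_map in HK; destruct HK as [g [Hg [tg ->]]].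
    * destruct (conway_form_right G g cG Hg) as [->|cg]; [discriminate|].
      apply (IHG g); auto using right_options_size.
    * destruct (conway_form_right H g cH Hg) as [->|cg]; [discriminate|].
      apply (IHH g); auto using right_options_size.
  (* Here a Right option [Infty] has no classical counterpart, but Right loses by choosing it, so
     Left needs no answer. *)
  + intros W; split; intros K HK.
    * destruct (conway_form_right G K cG HK) as [->|cK].
      { rewrite add_Infty_l by exact tH; reflexivity. }
      apply (IHG K); auto using right_options_size.
      apply W, right_moves_add; left; exists (conway_map K); split; [|easy].
      apply right_moves_conway_map; exists K.
      auto using conway_form_terminating.
    * destruct (conway_form_right H K cH HK) as [->|cK].
      { rewrite add_Infty_r by exact tG; reflexivity. }
      apply (IHH K); auto using right_options_size.
      apply W, right_moves_add; right; exists (conway_map K); split; [|easy].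
      apply right_moves_conway_map; exists K.
      auto using conway_form_terminating.
Qed.

Lemma conway_map_ge (G H : affine) : conway_form G -> conway_form H ->
  affine_ge G H -> game_ge (conway_map G) (conway_map H).
Proof.
intros cG cH GH.
set (X := conway_inv (game_opp (conway_map H))).
assert (cX : conway_form X) by apply conway_inv_form.
assert (WH : outcome_R (affine_add H X) = L).
{ apply outcome_conway_add; [assumption..|].
  unfold X; rewrite conway_invK; apply game_ge_refl. }
assert (WG : outcome_R (affine_add G X) = L).
(* The second alternative, that Right wins moving first in [H + X], contradicts [WH]. *)
{ destruct (GH X) as [_ [W|W]]; [apply cX | apply cX | exact W |].
  cbn in W; congruence. }
apply outcome_conway_add in WG; [|assumption..].
unfold X in WG; rewrite conway_invK in WG; exact WG.
Qed.

(** Induction on the total size of [G], [H] and [X]: a move in [X] is copied from one sum to the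
    other, and a move in [H] or [G] is handled by Left's reply, moving second, in [G - H]. *)
Lemma outcome_conway_inv_ge (G H : game) (X : affine) :
  game_ge G H -> terminating X = false ->
  (outcome_L (affine_add (conway_inv H) X) = L ->
   outcome_L (affine_add (conway_inv G) X) = L) /\
  (outcome_R (affine_add (conway_inv H) X) = L ->
   outcome_R (affine_add (conway_inv G) X) = L).
Proof.
remember (game_size G + game_size H + affine_size X) as n eqn:En.
revert G H X En; induction n as [n IH] using lt_wf_ind.
intros G H X -> GH tX.
assert (IH' : forall G' H' X',
  game_size G' + game_size H' + affine_size X' <
    game_size G + game_size H + affine_size X -> game_ge G' H' -> _)
  by (intros G' H' X' s; exact (IH _ s G' H' X' eq_refl)).
clear IH; rename IH' into IH.
assert (tG := conway_inv_terminating G).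
assert (tH := conway_inv_terminating H).
apply game_geP in GH as GH'; destruct GH' as [GR HL].
split.
- intros W; apply outcome_L_add in W; [|assumption..].
  destruct W as [[K [HK W]]|[K [HK W]]].
  + destruct (left_conway_inv_cases H K HK) as [->|[H' [HH ->]]].
    { rewrite add_Inftybar_l in W by exact tX; discriminate. }
    (* Left wins by moving from [H] to [H']. As [G >= H], Left also wins moving first in [G - H']:
       by a move of [G] to some [K >= H'], or through a Right option [K] of [H'] with [G >= K]. *)
    assert (sH := left_moves_size _ _ HH).
    destruct (proj1 (left_wins_first_sub _ _) (HL H' HH))
      as [[K [HK' ge]]|[K [HK' ge]]].
    * assert (sK := left_moves_size _ _ HK').
      apply outcome_L_add; [assumption..|left].
      exists (conway_inv K); split; [apply in_left_conway_inv, HK'|].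
      apply (IH K H' X); [lia | assumption..].
    (* No move has to be made in [G] yet: Left survives Right's move from [H'] to [K], hence wins
       moving first with [K] in place of [H], and induction transfers this win to [G]. *)
    * assert (sK := right_moves_size _ _ HK').
      apply (IH G K X); [lia | assumption.. |].
      apply outcome_R_add in W; [|apply conway_inv_terminating | exact tX].
      apply W, in_right_conway_inv, HK'.
  + apply outcome_L_add; [assumption..|right].
    exists K; split; [exact HK|].
    assert (sK := left_options_size _ _ HK).
    (* [X] may be a check, so this option can be terminating: [Infty] wins at once beside any form,
       and [Inftybar] contradicts the assumed win in the sum with [H]. *)
    destruct K.
    * rewrite add_Infty_r by exact tG; reflexivity.
    * rewrite add_Inftybar_r in W by exact tH; discriminate.
    * revert W; apply IH; [lia | assumption | reflexivity].
- intros W; apply outcome_R_add; [assumption..|].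
  (* [W] is kept intact for the case where Left answers in [G'] and [H] stays unmoved; its unfolded
     form serves the other cases. *)
  assert (W' := W); apply outcome_R_add in W'; [|assumption..].
  destruct W' as [WH WX].
  split; intros K HK.
  + destruct (right_conway_inv_cases G K HK) as [->|[G' [HG ->]]].
    { rewrite add_Infty_l by exact tX; reflexivity. }
    assert (sG := right_moves_size _ _ HG).
    (* Right has moved from [G] to [G']. Left replies to some [K >= H] in [G'], or else a Right
       option [K] of [H] satisfies [G' >= K], and Left's win after Right's move to [K] carries over
       to [G']. *)
    destruct (proj1 (left_wins_first_sub _ _) (GR G' HG))
      as [[K [HK' ge]]|[K [HK' ge]]].
    * assert (sK := left_moves_size _ _ HK').
      apply outcome_L_add; [apply conway_inv_terminating | exact tX | left].
      exists (conway_inv K); split; [apply in_left_conway_inv, HK'|].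
      apply (IH K H X); [lia | assumption..].
    * assert (sK := right_moves_size _ _ HK').
      apply (IH G' K X); [lia | assumption.. |].
      apply WH, in_right_conway_inv, HK'.
  + assert (sK := right_options_size _ _ HK).
    specialize (WX K HK).
    destruct K.
    * rewrite add_Infty_r by exact tG; reflexivity.
    * rewrite add_Inftybar_r in WX by exact tH; discriminate.
    * revert WX; apply IH; [lia | assumption | reflexivity].
Qed.

Lemma conway_inv_ge (G H : game) :
  game_ge G H -> affine_ge (conway_inv G) (conway_inv H).
Proof.
intros GH X n1 n2.
assert (tX : terminating X = false) by (destruct X; easy).
destruct (outcome_conway_inv_ge G H X GH tX) as [WL WR].
unfold outcome_ge, player_ge; cbn; split.
- destruct (outcome_L (affine_add (conway_inv H) X)); auto.
- destruct (outcome_R (affine_add (conway_inv H) X)); auto.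
Qed.

Theorem theorem49 :
  (forall G H : affine, conway_form G -> conway_form H ->
     affine_ge G H -> game_ge (conway_map G) (conway_map H)) /\
  (forall G H : game,
     game_ge G H -> affine_ge (conway_inv G) (conway_inv H)).
Proof. exact (conj conway_map_ge conway_inv_ge). Qed.
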